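(* Let $H$ be a fixed graph (not depending on $n$) with at least one edge. For every positive integer $k$, \[ p_k(H)=\Theta\bigl(n^{-1/d_k(H)}\bigr)\qquad (n\to\infty), \] where the implicit constants depend only on $H$ and $k$.
   Context: Graphs are finite and simple; $v_J,e_J$ denote the numbers of vertices and edges of $J$. For a finite set $X$ and $p\in[0,1]$, $\mu_p$ is the product measure on $2^X$: $\mu_p(\{A\})=p^{|A|}(1-p)^{|X\setminus A|}$. A family $\mathcal F\subseteq 2^X$ is increasing if closed under supersets and decreasing if closed under subsets. For a decreasing family $\mathcal D\subseteq 2^X$, $\mathcal D_{(k)}:=\{D_1\cup\cdots\cup D_k: D_i\in\mathcal D\}$. For an increasing family $\mathcal I\subseteq 2^X$, the $k$-threshold $p_k(\mathcal I)$ is the infimum of the set of $p\in[0,1]$ such that for every decreasing $\mathcal D\subseteq 2^X$ with $\mu_p(\mathcal D)\ge 1-\frac1{2k}$ we have $\mathcal D_{(k)}\cap\mathcal I\neq\emptyset$. Take $X=\binom{[n]}2$ and identify elements of $2^{\binom{[n]}2}$ with graphs on vertex set $[n]$. For a graph $H$ on at most $n$ vertices, $\mathcal I_H\subseteq 2^{\binom{[n]}2}$ is the family of all graphs on $[n]$ having a subgraph isomorphic to $H$, and $p_k(H):=p_k(\mathcal I_H)$ (which depends on $n$). The maximum density is $d(H)=\max\{e_J/v_J: J\text{ a subgraph of }H\text{ with }v_J\ge1\}$. A $k$-decomposition of $H$ is a sequence $(H_1,\dots,H_k)$ of subgraphs of $H$ with $E(H_1)\cup\cdots\cup E(H_k)=E(H)$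 (isolated vertices of $H$ need not appear in any $H_i$). The $k$-density $d_k(H)$ is the minimum of $\max_{i\in[k]}d(H_i)$ over all $k$-decompositions $(H_1,\dots,H_k)$ of $H$. *)

(* Defs.v *)
From mathcomp Require Import all_boot all_order all_algebra.
From mathcomp Require Import all_classical all_reals all_analysis.

Set Implicit Arguments.
Unset Strict Implicit.
Unset Printing Implicit Defensive.

Import Order.TTheory GRing.Theory Num.Theory.
Import numFieldNormedType.Exports.

Local Open Scope ring_scope.

Section Families.
Context {R : realType} {X : finType}.
Implicit Types (p : R) (k : nat) (F D I : {set {set X}}).

Definition product_measure p F : R :=
  \sum_(A in F) p ^+ #|A| * (1 - p) ^+ #|~: A|.

Definition decreasing_family D : Prop :=
  forall A B : {set X}, A \in D -> B \subset A -> B \in D.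

Definition increasing_family F : Prop :=
  forall A B : {set X}, A \in F -> A \subset B -> B \in F.

Definition kfold_union k D : {set {set X}} :=
  [set \bigcup_(i < k) f i | f : {ffun 'I_k -> {set X}} in ffun_on (mem D)].

Definition threshold k I : R :=
  inf [set p : R | 0 <= p <= 1 /\
    forall D : {set {set X}}, decreasing_family D ->
      1 - (2 * k%:R)^-1 <= product_measure p D ->
      kfold_union k D :&: I != finset.set0]%classic.

End Families.

Definition pairs (V : finType) := {e : {set V} | #|e| == 2%N}.

(* A graph with vertex set contained in [V]: a set of vertices together with a
   set of edges whose endpoints are among those vertices. *)
Definition wf_graph (V : finType) (G : {set V} * {set pairs V}) : bool :=
  [forall (e | e \in G.2), val e \subset G.1].

Definition graph (V : finType) :=
  {G : {set V} * {set pairs V} | wf_graph G}.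

Definition vertices (V : finType) (G : graph V) : {set V} := (val G).1.
Definition edges (V : finType) (G : graph V) : {set pairs V} := (val G).2.

Definition adjacent (V : finType) (G : graph V) (x y : V) : bool :=
  [exists e in edges G, val e == [set x; y]%SET].

Definition subgraph (V : finType) (J G : graph V) : bool :=
  (vertices J \subset vertices G) && (edges J \subset edges G).

Definition isomorphic (U V : finType) (G : graph U) (J : graph V) : Prop :=
  exists f : {x | x \in vertices G} -> {y | y \in vertices J},
    bijective f /\
    forall x x', adjacent G (val x) (val x') = adjacent J (val (f x)) (val (f x')).

Fact wf_spanning (V : finType) (E : {set pairs V}) :
  wf_graph ([set: V]%SET, E).
Proof. by apply/forall_inP => e _; exact: finset.subsetT. Qed.

(* The graph with vertex set all of [V] and edge set [E]. *)
Definition spanning_graph (V : finType) (E : {set pairs V}) : graph V :=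
  exist _ ([set: V]%SET, E) (wf_spanning E).

Definition containing_family (V : finType) (H : graph V) (n : nat) :
    {set {set pairs 'I_n}} :=
  [set E | `[< exists J : graph 'I_n,
                 subgraph J (spanning_graph E) /\ isomorphic H J >]]%SET.

Fact increasing_containing_family (V : finType) (H : graph V) (n : nat) :
  increasing_family (containing_family H n).
Proof.
move=> A B; rewrite !finset.inE => /asboolP[J [/andP[JV JA] isoHJ]] AB.
apply/asboolP; exists J; split=> //.
by rewrite /subgraph JV; exact: fintype.subset_trans JA AB.
Qed.

Definition graph_threshold {R : realType} (V : finType) (H : graph V)
    (k n : nat) : R :=
  threshold k (containing_family H n).

Section Density.
Context {R : realType} {V : finType}.
Implicit Types (G H J : graph V) (k : nat).

(* The densities are nonnegative, so the default 0 only matters for the graph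
   without vertices, to which it gives density 0. *)
Definition max_density G : R :=
  \big[Num.max/0]_(J | subgraph J G && (0 < #|vertices J|)%N)
    (#|edges J|%:R / #|vertices J|%:R).

Definition is_decomposition k H (D : {ffun 'I_k -> graph V}) : bool :=
  [forall i, subgraph (D i) H] && (\bigcup_(i < k) edges (D i) == edges H).

(* For [0 < k] the default [max_density H] is among the values minimised: it is
   attained by the constant decomposition [(H, ..., H)]. *)
Definition k_density k H : R :=
  \big[Num.min/max_density H]_(D : {ffun 'I_k -> graph V} |
      is_decomposition H D)
    \big[Num.max/0]_(i < k) max_density (D i).

End Density.

(* Main.v *)
(* Write d for the k-density of H and v for its number of vertices.

   Lower bound. For p = c n^(-1/d), the union bound shows that with probability
   at least 1 - 1/(2k) every set W of at most v vertices spans fewer than d|W|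
   edges. This defines a decreasing family. If a union of k of its members
   contained H, its pieces would decompose H, and one of them would have a
   subgraph of density at least d.

   Upper bound. Let (H_1, ..., H_k) be an optimal decomposition, p = C n^(-1/d),
   and D a decreasing family of measure at least 1 - 1/(2k). If at least a 1/k
   proportion of the placements of H_i were outside D, then by Chebyshev's
   inequality G(n,p) would contain one of those with probability at least 3/4,
   and would then be outside D. So less than a 1/k proportion of the placements
   is bad for each i, and some placement puts every H_i in D. Only placements
   sending each vertex x to its own block of m = n/v vertices are used: they are
   indexed by functions, and two of them share exactly the edges on which these
   functions agree. *)
Require Import Defs.
From mathcomp Require Import all_boot all_order all_algebra.
From mathcomp Require Import all_classical all_reals all_analysis.
From mathcomp Require Import ring lra.
Set Implicit Arguments.
Unset Strict Implicit.
Unset Printing Implicit Defensive.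
Import Order.TTheory GRing.Theory Num.Theory.
Import numFieldNormedType.Exports.
Local Open Scope classical_set_scope.
Local Open Scope ring_scope.

(** * Product measure: supersets of a set, union bound, second moment *)

Section ProductMeasure.
Context {R : realType} {X : finType}.
Implicit Types (p : R) (A S : {set X}) (F G D : {set {set X}}).

Lemma product_measure_supset p S :
  product_measure p [set A : {set X} | S \subset A]%SET = p ^+ #|S|.
Proof.
(* Each factor is [p] on [S] and 1 elsewhere. Expanding the product, by choosing one summand for
   each element, gives the sum over [A]; a set [A] that misses an element of [S] contributes 0. *)
transitivity (\prod_(i : X) (p + if i \in S then 0 else 1 - p)); last first.
  rewrite -prodr_const [RHS]big_mkcond /=; apply: eq_bigr => i _.
  by case: ifP => _; ring.
rewrite bigA_distr /product_measure big_mkcond /=; apply: eq_bigr => A _.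
rewrite finset.inE (bigID (mem A)) /=.
rewrite (eq_bigr (fun=> p)) => [|i /= ->//]; rewrite prodr_const.
case: ifPn => [SA|/fintype.subsetPn[x xS xA]]; last first.
  by rewrite [X in _ * X](bigD1 x) //= (negPf xA) xS mul0r mulr0.
congr (_ * _); rewrite -prodr_const; apply: eq_big => [i|i]; rewrite finset.inE //.
move=> iA; rewrite (negPf iA); case: ifPn => // iS.
by rewrite (fintype.subsetP SA _ iS) in iA.
Qed.

Lemma product_measure_setT p : product_measure p [set: {set X}]%SET = 1.
Proof.
rewrite -[RHS](expr0 p) -(cards0 X) -product_measure_supset.
congr product_measure.
by apply/setP => A; rewrite !finset.inE finset.sub0set.
Qed.

Lemma product_measureE p F :
  product_measure p F =
  \sum_(A : {set X}) p ^+ #|A| * (1 - p) ^+ #|~: A| * (A \in F)%:R.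
Proof.
rewrite /product_measure big_mkcond /=; apply: eq_bigr => A _.
by case: ifP; rewrite ?mulr1 ?mulr0.
Qed.

Section Probability.
Variable p : R.
Hypothesis p01 : 0 <= p <= 1.

Lemma weight_ge0 A : 0 <= p ^+ #|A| * (1 - p) ^+ #|~: A|.
Proof. by case/andP: p01 => p0 p1; rewrite mulr_ge0 ?exprn_ge0 ?subr_ge0. Qed.

Lemma product_measure_le F G :
  F \subset G -> product_measure p F <= product_measure p G.
Proof.
move=> FG; rewrite !product_measureE; apply: ler_sum => A _.
rewrite ler_wpM2l ?weight_ge0 // ler_nat.
by case: (boolP (A \in F)) => // /(fintype.subsetP FG) ->.
Qed.

(** Union bound, proved pointwise: every [A] either avoids all the [S i] or is counted by at least
    one of the events [S i \subset A]. *)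
Lemma product_measure_avoid_ge (I : finType) (P : pred I) (S : I -> {set X}) :
  1 - \sum_(i | P i) p ^+ #|S i| <=
  product_measure p [set A : {set X} | [forall (i | P i), ~~ (S i \subset A)]]%SET.
Proof.
under eq_bigr do rewrite -product_measure_supset product_measureE.
rewrite lerBlDr -[leLHS](product_measure_setT p) !product_measureE.
rewrite exchange_big /= -big_split /=; apply: ler_sum => A _.
rewrite -mulr_sumr -mulrDr ler_wpM2l ?weight_ge0 // !finset.inE.
have [_|] := boolP [forall (i | P i), ~~ (S i \subset A)].
  by rewrite lerDl sumr_ge0.
rewrite negb_forall => /existsP[i]; rewrite negb_imply negbK => /andP[Pi SA].
by rewrite add0r (bigD1 i) //= finset.inE SA lerDl sumr_ge0.
Qed.

(* Chebyshev's inequality for the number of indices [i] with [S i \subset A]. *)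
Lemma product_measure_avoid_le (I : finType) (P : pred I) (S : I -> {set X}) :
  (\sum_(i | P i) p ^+ #|S i|) ^+ 2 *
    product_measure p [set A : {set X} | [forall (i | P i), ~~ (S i \subset A)]]%SET <=
  \sum_(i | P i) \sum_(j | P j) p ^+ #|S i :|: S j| -
    (\sum_(i | P i) p ^+ #|S i|) ^+ 2.
Proof.
set M := \sum_(i | P i) p ^+ #|S i|.
pose w A : R := p ^+ #|A| * (1 - p) ^+ #|~: A|.
pose N A : R := \sum_(i | P i) (S i \subset A)%:R.
have w1 : \sum_A w A = 1.
  rewrite -(product_measure_setT p) product_measureE; apply: eq_bigr => A _.
  by rewrite finset.inE mulr1.
have wN : \sum_A w A * N A = M.
  under eq_bigr do rewrite mulr_sumr.
  rewrite exchange_big /=; apply: eq_bigr => i _.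
  rewrite -product_measure_supset product_measureE.
  by apply: eq_bigr => A _; rewrite finset.inE.
have wN2 : \sum_A w A * N A ^+ 2 =
    \sum_(i | P i) \sum_(j | P j) p ^+ #|S i :|: S j|.
  under eq_bigr do rewrite expr2 mulr_suml mulr_sumr.
  rewrite exchange_big /=; apply: eq_bigr => i _.
  under eq_bigr do rewrite mulr_sumr mulr_sumr.
  rewrite exchange_big /=; apply: eq_bigr => j _.
  rewrite -product_measure_supset product_measureE.
  by apply: eq_bigr => A _; rewrite finset.inE finset.subUset -natrM mulnb.
(* The right-hand side is the variance of [N], whose mean is [M]. On the event that no [S i] lies in
   [A], [N A = 0], so the squared deviation is exactly [M ^+ 2]. *)
have -> : \sum_(i | P i) \sum_(j | P j) p ^+ #|S i :|: S j| - M ^+ 2 =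
    \sum_A w A * (N A - M) ^+ 2.
  rewrite -wN2; transitivity (\sum_A (w A * N A ^+ 2 +
      ((w A * N A) * (- 2 * M) + w A * M ^+ 2))); last first.
    by apply: eq_bigr => A _; ring.
  by rewrite !big_split /= -!mulr_suml wN w1; ring.
rewrite product_measureE mulr_sumr; apply: ler_sum => A _.
rewrite mulrCA ler_wpM2l ?weight_ge0 // finset.inE.
have [/forall_inP none_A|_] := boolP [forall (i | P i), ~~ (S i \subset A)]; last first.
  by rewrite mulr0 sqr_ge0.
by rewrite [N A]big1 ?sub0r ?sqrrN ?mulr1 // => i /none_A/negPf ->.
Qed.

End Probability.
End ProductMeasure.

(** * Images of edge sets under vertex maps, and copies of a graph *)

Section EdgeImage.
Context {U W : finType}.
Implicit Types (g : U -> W) (E : {set pairs U}) (A : {set U}).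

(** The image is formed among sets and then restricted to pairs, so [g] may be any function: an edge
    that [g] collapses to one point just disappears. *)
Definition edge_image g E : {set pairs W} :=
  [set e : pairs W | val e \in (fun e' : pairs U => g @: val e') @: E]%SET.

Lemma edge_imageP g E (e : pairs W) :
  reflect (exists2 e', e' \in E & val e = (g @: val e')%SET)
          (e \in edge_image g E).
Proof. by rewrite finset.inE; apply: imsetP. Qed.

Lemma imset_pair g A (e : pairs U) :
  {in A &, injective g} -> val e \subset A ->
  exists e' : pairs W, val e' = (g @: val e)%SET.
Proof.
move=> gI eA; have c2 : #|(g @: val e)%SET| == 2.
  rewrite card_in_imset ?(eqP (valP e)) // => x y xe ye.
  by apply: gI; apply: (fintype.subsetP eA).
by exists (exist (fun B : {set W} => #|B| == 2) _ c2).
Qed.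

Lemma imset_pair_inj g A (e e' : pairs U) :
  {in A &, injective g} -> val e \subset A -> val e' \subset A ->
  (g @: val e = g @: val e')%SET -> e = e'.
Proof.
move=> gI eA e'A ee'; apply/val_inj/eqP.
rewrite eqEcard (eqP (valP e)) (eqP (valP e')) leqnn andbT.
apply/fintype.subsetP => x xe.
have /imsetP[y ye' gxy] : g x \in (g @: val e')%SET by rewrite -ee' imset_f.
by rewrite (gI _ _ (fintype.subsetP eA _ xe) (fintype.subsetP e'A _ ye') gxy).
Qed.

Lemma card_edge_image g A E :
  {in A &, injective g} -> (forall e, e \in E -> val e \subset A) ->
  #|edge_image g E| = #|E|.
Proof.
move=> gI EA; rewrite -(card_imset (mem (edge_image g E)) val_inj).
rewrite -(@card_in_imset _ _ (fun e : pairs U => g @: val e)%SET (mem E)); last first.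
  by move=> e e' eE e'E; apply: (imset_pair_inj gI); apply: EA.
apply: eq_card => B; apply/imsetP/imsetP => -[e].
  by move=> /edge_imageP[e' e'E ee'] ->; exists e'.
move=> eE ->; have [e' ee'] := imset_pair gI (EA _ eE).
by exists e' => //; apply/edge_imageP; exists e.
Qed.

Lemma edge_image_bigcup g k (F : 'I_k -> {set pairs U}) :
  (\bigcup_(i < k) edge_image g (F i) = edge_image g (\bigcup_(i < k) F i))%SET.
Proof.
apply/setP => e; apply/bigcupP/edge_imageP => [[i _ /edge_imageP[e' e'F ee']]|].
  by exists e' => //; apply/bigcupP; exists i.
move=> [e' /bigcupP[i _ e'F] ee']; exists i => //.
by apply/edge_imageP; exists e'.
Qed.

End EdgeImage.

Lemma edge_subset (U : finType) (G : graph U) (e : pairs U) :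
  e \in edges G -> val e \subset vertices G.
Proof. by move=> eG; apply: (forall_inP (valP G)). Qed.

Lemma adjacentP (U : finType) (G : graph U) (x y : U) :
  reflect (exists2 e, e \in edges G & val e = [set x; y]%SET) (Defs.adjacent G x y).
Proof.
apply: (iffP existsP) => [[e /andP[eG /eqP ve]]|[e eG ve]]; exists e => //.
by rewrite eG ve /=.
Qed.

Section Embedding.
Context {U W : finType}.
Implicit Types (g : U -> W) (H : graph U).

Lemma embedding_isomorphic g H (E : {set pairs W}) :
  injective g -> edge_image g (edges H) \subset E ->
  exists J : graph W, subgraph J (spanning_graph E) /\ isomorphic H J.
Proof.
move=> gI HE.
have wfJ : wf_graph ((g @: vertices H)%SET, edge_image g (edges H)).
  apply/forall_inP => e /edge_imageP[e' e'H ->].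
  exact/imsetS/edge_subset.
exists (exist (@wf_graph W) _ wfJ); split; first by rewrite /subgraph HE finset.subsetT.
pose f (x : {x | x \in vertices H}) : {y | y \in (g @: vertices H)%SET} :=
  exist _ (g (val x)) (imset_f g (valP x)).
exists f; split.
  apply: inj_card_bij => [x y /(congr1 val)/gI/val_inj //|].
  by rewrite !card_sig; apply: leq_imset_card.
move=> x y; apply/adjacentP/adjacentP => -[e eE ve].
  have [e' ee'] := imset_pair (in2W gI) (edge_subset eE).
  exists e'; first by apply/edge_imageP; exists e.
  by rewrite ee' ve imsetU1 imset_set1.
move: eE => /edge_imageP[e' e'E ee']; exists e' => //.
by apply: (imset_inj gI); rewrite -ee' ve imsetU1 imset_set1.
Qed.

Lemma isomorphic_embedding H (J : graph W) :
  edges H != finset.set0 -> isomorphic H J ->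
  exists g, {in vertices H &, injective g} /\
            edge_image g (edges H) \subset edges J.
Proof.
move=> /set0Pn[e0 e0H] [f [fbij fadj]].
(* The isomorphism is defined on the vertices of [H] only. An endpoint of an edge serves as the
   default that extends it to a total function [g]. *)
have /card_gt0P[z ze0] : (0 < #|val e0|)%N by rewrite (eqP (valP e0)).
pose z0 : {x | x \in vertices H} :=
  exist _ z (fintype.subsetP (edge_subset e0H) _ ze0).
pose g x := val (f (insubd z0 x)).
have gE x (xH : x \in vertices H) : g x = val (f (exist _ x xH)).
  by congr (val (f _)); apply: val_inj; rewrite val_insubd xH.
exists g; split=> [x y xH yH|].
  by rewrite !gE => /val_inj/(bij_inj fbij)/(congr1 val).
apply/fintype.subsetP => e' /edge_imageP[e eH e'e].
have /cards2P[x [y [_ exy]]] := valP e.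
have xH : x \in vertices H.
  by apply: (fintype.subsetP (edge_subset eH)); rewrite exy set21.
have yH : y \in vertices H.
  by apply: (fintype.subsetP (edge_subset eH)); rewrite exy set22.
have /adjacentP[e'' e''J ve''] : Defs.adjacent J (g x) (g y).
  by rewrite !gE -fadj; apply/adjacentP; exists e.
have -> : e' = e'' by apply: val_inj; rewrite e'e exy ve'' imsetU1 imset_set1.
exact: e''J.
Qed.

End Embedding.

(** * Maximum density and k-density *)

Section Density.
Context {R : realType} {V : finType}.
Implicit Types (G H J : graph V) (k : nat).

Lemma card_edges_le_density G J (d : R) :
  max_density G <= d -> subgraph J G ->
  #|edges J|%:R <= d * #|vertices J|%:R.
Proof.
move=> Gd JG; have [J0|] := posnP #|vertices J|; last first.
  move=> J0; rewrite -ler_pdivrMr ?ltr0n //; apply: le_trans Gd.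
  by apply: (le_bigmax_cond _ (fun J => _)); rewrite JG J0.
(* The maximum ranges over subgraphs with a vertex, so the case without vertices is separate; there
   are then no edges either. *)
have -> : edges J = finset.set0.
  apply/eqP; apply: contraT => /set0Pn[e /edge_subset eJ].
  by have := subset_leq_card eJ; rewrite J0 (eqP (valP e)).
by rewrite J0 cards0 mulr0.
Qed.

Lemma max_density_ge G (d : R) :
  0 < d -> d <= max_density G ->
  exists J, [/\ subgraph J G, (0 < #|vertices J|)%N &
                d * #|vertices J|%:R <= #|edges J|%:R].
Proof.
move=> d0 dG; apply: contrapT => noJ.
suff : max_density G < d by rewrite ltNge dG.
(* Positivity of [d] rules out that the default 0 of the maximum is what reaches [d]. *)
apply: bigmax_lt => // J /andP[JG J0]; rewrite ltNge; apply/negP => dJ.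
by apply: noJ; exists J; split; rewrite // -ler_pdivlMr ?ltr0n.
Qed.

Lemma max_density_gt0 G : edges G != finset.set0 -> 0 < max_density G :> R.
Proof.
move=> G0; have /set0Pn[e eG] := G0.
have v0 : (0 < #|vertices G|)%N.
  by apply: leq_trans (subset_leq_card (edge_subset eG)); rewrite (eqP (valP e)).
have GG : subgraph G G by rewrite /subgraph !fintype.subxx.
apply: lt_le_trans (_ : #|edges G|%:R / #|vertices G|%:R <= _).
  by rewrite divr_gt0 // ltr0n // card_gt0.
by apply: (le_bigmax_cond _ (fun J => _)); rewrite GG v0.
Qed.

Lemma k_density_attained k H :
  (0 < k)%N -> exists D : {ffun 'I_k -> graph V},
    is_decomposition H D /\ forall i, max_density (D i) <= k_density k H :> R.
Proof.
move=> k0; pose D0 : {ffun 'I_k -> graph V} := [ffun=> H].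
have D0P : is_decomposition H D0.
  apply/andP; split.
    by apply/forallP => i; rewrite ffunE /subgraph !fintype.subxx.
  apply/eqP/setP => e; apply/bigcupP/idP => [[i _]|eH]; first by rewrite ffunE.
  by exists (Ordinal k0) => //; rewrite ffunE.
have [D DP minD] := arg_minP (fun D : {ffun 'I_k -> graph V} =>
  \big[Num.max/0]_(i < k) max_density (D i) : R) D0P.
exists D; split=> // i; apply: le_trans (le_bigmax 0 (fun j => max_density (D j)) i) _.
(* The default of the minimum in [k_density] is the value of the constant decomposition, so the
   minimiser [D] is compared with it like with any other. *)
have D0H : \big[Num.max/0]_(i < k) max_density (D0 i) = max_density H :> R.
  apply/eqP; rewrite eq_le; apply/andP; split.
    by apply: bigmax_le => [|j _]; [apply: bigmax_ge_id|rewrite ffunE].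
  by have := le_bigmax 0 (fun j => max_density (D0 j) : R) (Ordinal k0); rewrite ffunE.
apply: le_bigmin => [|D' D'P]; last exact: minD.
by rewrite -D0H; apply: minD.
Qed.

Lemma k_density_gt0 k H :
  (0 < k)%N -> edges H != finset.set0 -> 0 < k_density k H :> R.
Proof.
move=> k0 /set0Pn[e eH]; have [D [/andP[_ /eqP DH] Dd]] := k_density_attained H k0.
move: eH; rewrite -DH => /bigcupP[i _ eD].
by apply: lt_le_trans (Dd i); apply: max_density_gt0; apply/set0Pn; exists e.
Qed.

Lemma decomposition_ge k H (D : {ffun 'I_k -> graph V}) :
  (0 < k)%N -> edges H != finset.set0 -> is_decomposition H D ->
  exists i J, [/\ subgraph J (D i), (0 < #|vertices J|)%N &
                  k_density k H * #|vertices J|%:R <= #|edges J|%:R :> R].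
Proof.
move=> k0 H0 DP; have d0 := k_density_gt0 k0 H0.
have [i di] : exists i, k_density k H <= max_density (D i) :> R.
  apply: contrapT => noi; suff : k_density k H < k_density k H :> R by rewrite ltxx.
  apply: le_lt_trans (bigmin_le_cond _ _ DP) _.
  by apply: bigmax_lt => // i _; rewrite ltNge; apply/negP => di; apply: noi; exists i.
by exists i; apply: max_density_ge.
Qed.

End Density.

(** * Sparse graphs form a decreasing family of large measure *)

Section SparseFamily.
Context {R : realType} {U : finType}.
Implicit Types (W : {set U}) (A B S : {set pairs U}) (v : nat) (d p : R).

Definition edges_within A W : {set pairs U} := [set e in A | val e \subset W]%SET.

(** The empty [W] is left out because the strict inequality would fail for it. *)
Definition sparse_family v d : {set {set pairs U}} :=
  [set A : {set pairs U} | [forall (W : {set U} | (0 < #|W| <= v)%N),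
     #|edges_within A W|%:R < d * #|W|%:R]]%SET.

Lemma edges_withinS A B W : B \subset A -> edges_within B W \subset edges_within A W.
Proof.
move=> /fintype.subsetP BA; apply/fintype.subsetP => e.
by rewrite !finset.inE => /andP[/BA -> ->].
Qed.

Lemma decreasing_sparse_family v d : decreasing_family (sparse_family v d).
Proof.
move=> A B; rewrite !finset.inE => /forall_inP sA BA; apply/forall_inP => W Wv.
by apply: le_lt_trans (sA W Wv); rewrite ler_nat subset_leq_card ?edges_withinS.
Qed.

(** A crude count suffices: the pairs inside [W] are among its at most [2 ^ v] subsets. *)
Lemma card_subsets_within v W :
  (#|W| <= v)%N ->
  (#|[set S : {set pairs U} | edges_within S W == S]%SET| <= 2 ^ 2 ^ v)%N.
Proof.
move=> Wv; pose F := edges_within [set: pairs U]%SET W.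
have FW : (#|F| <= 2 ^ v)%N.
  rewrite -(card_imset _ val_inj); apply: leq_trans (_ : 2 ^ #|W| <= _)%N.
    rewrite -card_powerset; apply: subset_leq_card.
    apply/fintype.subsetP => B /imsetP[e]; rewrite finset.inE => /andP[_ eW] ->.
    by rewrite finset.inE.
  by rewrite leq_exp2l.
apply: leq_trans (_ : 2 ^ #|F| <= _)%N; last by rewrite leq_exp2l.
rewrite -card_powerset; apply: subset_leq_card; apply/fintype.subsetP => S.
by rewrite !finset.inE => /eqP <-; apply/edges_withinS/finset.subsetT.
Qed.

(** Grouped by size, the sets with [i] elements contribute ['C(#|U|, i) / #|U| ^ i], which is at
    most 1, and there are [v] sizes. *)
Lemma sum_card_pow_le v :
  \sum_(W : {set U} | (0 < #|W| <= v)%N) (#|U|%:R^-1 : R) ^+ #|W| <= v%:R.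
Proof.
have [U0|U0] := posnP #|U|.
  rewrite big1 ?ler0n // => W /andP[W0 _].
  by have := max_card W; rewrite U0 leqNgt W0.
apply: le_trans (_ : \sum_(W : {set U} | (0 < #|W| <= v)%N)
    \sum_(i < v | #|W| == i.+1) (#|U|%:R^-1 : R) ^+ i.+1 <= _).
  apply: ler_sum => W /andP[W0 Wv].
  have Wv' : (#|W|.-1 < v)%N by rewrite prednK.
  by rewrite (bigD1 (Ordinal Wv')) /= ?prednK // lerDl sumr_ge0.
rewrite (exchange_big_dep predT) //=.
have -> : v%:R = \sum_(i < v) 1 :> R by rewrite sumr_const card_ord.
apply: ler_sum => i _; rewrite sumr_const -[leLHS]mulr_natl exprVn.
rewrite ler_pdivrMr ?exprn_gt0 ?ltr0n // mul1r -natrX ler_nat.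
apply: leq_trans (_ : 'C(#|U|, i.+1) <= _)%N.
  rewrite -card_draws -cardsE; apply: subset_leq_card.
  by apply/fintype.subsetP => W; rewrite !finset.inE => /andP[].
apply: leq_trans (_ : #|U| ^_ i.+1 <= _)%N.
  by rewrite -bin_ffact leq_pmulr ?fact_gt0.
elim: i.+1 => // j IHj; rewrite ffactnSr expnSr.
by rewrite leq_mul // leq_subr.
Qed.

Lemma sparse_family_measure v d (delta p : R) :
  (0 < #|U|)%N -> 0 < d -> 0 < delta <= 1 ->
  0 <= p <= (delta / #|U|%:R) `^ d^-1 ->
  1 - (2 ^ 2 ^ v)%:R * v%:R * delta <= product_measure p (sparse_family v d).
Proof.
move=> U0 d0 /andP[delta0 delta1] /andP[p0 pq].
have r0 : 0 < delta / #|U|%:R by rewrite divr_gt0 ?ltr0n.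
have r1 : delta / #|U|%:R <= 1.
  by rewrite ler_pdivrMr ?ltr0n // mul1r (le_trans delta1) ?ler1n.
set q := _ `^ d^-1 in pq; have q0 : 0 < q by apply: powR_gt0.
have q1 : q <= 1.
  have := ge0_ler_powR (ltW (_ : 0 < d^-1)) _ _ r1.
  by rewrite powR1 !nnegrE invr_gt0 d0 (ltW r0) ler01; apply.
have p1 : p <= 1 by apply: le_trans q1.
have p01 : 0 <= p <= 1 by rewrite p0.
(* A graph that is not sparse contains all of some edge set [S] lying within a small [W] and having
   at least [d * #|W|] edges; the union bound runs over such pairs. *)
pose P (WS : {set U} * {set pairs U}) := [&& (0 < #|WS.1| <= v)%N,
  edges_within WS.2 WS.1 == WS.2 & d * #|WS.1|%:R <= #|WS.2|%:R].
(* Since [q <= 1], [p ^ #|S|] is at most [q ^ (d * #|W|) = (delta / #|U|) ^ #|W|]. As [W] is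
   nonempty and [delta <= 1], one factor [delta] can be kept and the others dropped. *)
have Pp WS : P WS -> p ^+ #|WS.2| <= delta * (#|U|%:R^-1) ^+ #|WS.1|.
  case: WS => W S /and3P[/= /andP[W0 _] _ dW].
  apply: le_trans (_ : q ^+ #|S| <= _).
    by rewrite lerXn2r ?nnegrE // ltW.
  rewrite -powR_mulrn ?(ltW q0) //.
  apply: le_trans (ger_powR _ dW) _; first by rewrite q0.
  rewrite powRrM /q -[_ `^ d]powRrM mulVf ?gt_eqF // powRr1 ?(ltW r0) //.
  rewrite powR_mulrn ?(ltW r0) // exprMn ler_wpM2r ?exprn_ge0 ?invr_ge0 //.
  by case: #|W| W0 => // w _; rewrite exprS ler_piMr ?exprn_ile1 // ltW.
pose avoid := [set A : {set pairs U} | [forall (WS | P WS), ~~ (WS.2 \subset A)]]%SET.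
apply: le_trans (product_measure_le p01 (_ : avoid \subset _)); last first.
  apply/fintype.subsetP => A; rewrite !finset.inE => /forall_inP avoidA.
  apply/forall_inP => W Wv; rewrite ltNge; apply/negP => dW.
  have /avoidA : P (W, edges_within A W).
    rewrite /P /= Wv dW andbT; apply/eqP/setP => e.
    by rewrite !finset.inE -andbA andbb.
  rewrite /= => /negP; apply.
  by apply/fintype.subsetP => e; rewrite finset.inE => /andP[].
apply: le_trans (product_measure_avoid_ge p01 P snd).
rewrite lerB //; apply: le_trans (ler_sum _ Pp) _.
rewrite -mulr_sumr mulrC ler_wpM2r ?(ltW delta0) //.
apply: le_trans (_ : \sum_(W : {set U} | (0 < #|W| <= v)%N)
   \sum_(S : {set pairs U} | edges_within S W == S) (#|U|%:R^-1) ^+ #|W| <= _).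
  rewrite pair_big_dep /=; rewrite [leLHS]big_mkcond [leRHS]big_mkcond /=.
  apply: ler_sum => -[W S] _; rewrite /P /=.
  by rewrite andbA; case: ifP => [/andP[-> _] //|_]; case: ifP.
apply: le_trans (_ : \sum_(W : {set U} | (0 < #|W| <= v)%N)
   (2 ^ 2 ^ v)%:R * (#|U|%:R^-1) ^+ #|W| <= _).
  apply: ler_sum => W /andP[_ Wv]; rewrite sumr_const -[leLHS]mulr_natl.
  rewrite ler_wpM2r ?exprn_ge0 ?invr_ge0 // ler_nat.
  by apply: leq_trans (card_subsets_within Wv); rewrite cardsE.
by rewrite -mulr_sumr ler_wpM2l // sum_card_pow_le.
Qed.

End SparseFamily.

(** * Lower bound on the threshold *)

Section LowerBound.
Context {R : realType} {V : finType}.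
Variables (H : graph V) (k : nat).
Hypotheses (H0 : edges H != finset.set0) (k0 : (0 < k)%N).

(* Pulling the [k] pieces back along the embedding gives a decomposition of [H],
   one member of which has a subgraph of density at least [k_density k H]. *)
Lemma sparse_family_union_avoids n :
  kfold_union k (sparse_family #|V| (k_density k H : R)) :&:
    containing_family H n = finset.set0.
Proof.
apply/setP => A; rewrite !finset.inE; apply/negP => /andP[].
move=> /imsetP[f /ffun_onP fsparse ->] /asboolP[J [/andP[_ /= JA] isoJ]].
have [g [gI HJ]] := isomorphic_embedding H0 isoJ.
have wfE i : wf_graph (vertices H, [set e in edges H |
    edge_image g [set e] \subset f i]%SET).
  by apply/forall_inP => e; rewrite finset.inE => /andP[/edge_subset].
pose D : {ffun 'I_k -> graph V} := [ffun i => exist (@wf_graph V) _ (wfE i)].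
have DP : is_decomposition H D.
  apply/andP; split.
    apply/forallP => i; rewrite ffunE /subgraph /= fintype.subxx /=.
    by apply/fintype.subsetP => e; rewrite finset.inE => /andP[].
  apply/eqP/setP => e; apply/bigcupP/idP => [[i _]|eH].
    by rewrite ffunE finset.inE => /andP[].
  have [e' ee'] := imset_pair gI (edge_subset eH).
  have e'H : e' \in edge_image g (edges H) by apply/edge_imageP; exists e.
  have /bigcupP[i _ e'i] := fintype.subsetP JA _ (fintype.subsetP HJ _ e'H).
  exists i => //; rewrite ffunE finset.inE eH /=.
  apply/fintype.subsetP => e'' /edge_imageP[e1 /finset.set1P -> e''e].
  by have -> : e'' = e' by apply: val_inj; rewrite e''e ee'.
have [i [K [KD K0 dK]]] := decomposition_ge (R := R) k0 H0 DP.
move: KD; rewrite ffunE => /andP[/= KV KE].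
have gIK : {in vertices K &, injective g}.
  by move=> x y xK yK; apply: gI; apply: (fintype.subsetP KV).
(* The image of the vertices of [K] has as many elements as [K] has vertices and spans in [f i] at
   least as many edges as [K] has, against the sparsity of [f i]. *)
have := fsparse i; rewrite finset.inE => /forall_inP/(_ (g @: vertices K)%SET).
rewrite card_in_imset // K0 max_card => /(_ isT); rewrite ltNge => /negP; apply.
apply: le_trans dK _; rewrite ler_nat -(card_edge_image gIK (@edge_subset _ K)).
apply: subset_leq_card; apply/fintype.subsetP => e' /edge_imageP[e eK e'e].
rewrite finset.inE e'e imsetS ?edge_subset // andbT.
have := fintype.subsetP KE _ eK; rewrite finset.inE => /andP[_ /fintype.subsetP]; apply.
by apply/edge_imageP; exists e; rewrite ?finset.inE.
Qed.

Lemma lower_bound : exists2 c : R, 0 < c &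
  forall n (p : R), (0 < n)%N -> 0 <= p <= 1 ->
    (forall D : {set {set pairs 'I_n}}, decreasing_family D ->
      1 - (2 * k%:R)^-1 <= product_measure p D ->
      kfold_union k D :&: containing_family H n != finset.set0) ->
    c * n%:R `^ (- (k_density k H)^-1) <= p.
Proof.
set d := k_density k H; have d0 : 0 < d := k_density_gt0 k0 H0.
pose K : R := (2 ^ 2 ^ #|V|)%:R * #|V|%:R.
have K0 : 0 <= K by rewrite mulr_ge0.
(* This makes the failure probability [K * delta] at most [1 / (2k)]; the summand 1 keeps the
   denominator positive and gives [delta <= 1]. *)
pose delta : R := (2 * k%:R * (1 + K))^-1.
have k1 : 1 <= k%:R :> R by rewrite ler1n.
have delta0 : 0 < delta by rewrite invr_gt0 !mulr_gt0 ?ltr0n // ltr_wpDr.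
have delta1 : delta <= 1 by rewrite invf_le1 ?mulr_gt0 ?ltr0n ?ltr_wpDr //; nra.
have Kdelta : K * delta <= (2 * k%:R)^-1.
  rewrite /delta invfM mulrCA ler_piMr ?invr_ge0 ?mulr_ge0 ?ler0n //.
  by rewrite ler_pdivrMr ?ltr_wpDr // mul1r lerDr.
exists (delta `^ d^-1); first exact: powR_gt0.
move=> n p n0 /andP[p0 p1] thr.
have <- : (delta / n%:R) `^ d^-1 = delta `^ d^-1 * n%:R `^ (- d^-1).
  rewrite powRM ?(ltW delta0) ?invr_ge0 //.
  by rewrite -(powR_inv1 (ler0n R n)) -powRrM mulN1r.
rewrite leNgt; apply/negP => pq.
have : kfold_union k (sparse_family #|V| d) :&: containing_family H n != finset.set0.
  apply: thr; first exact: decreasing_sparse_family.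
  have := @sparse_family_measure R 'I_n #|V| d delta p.
  rewrite card_ord n0 d0 delta0 delta1 p0 (ltW pq) => /(_ isT isT isT isT).
  by apply: le_trans; rewrite lerB.
by rewrite sparse_family_union_avoids eqxx.
Qed.

End LowerBound.

(** * Random placements in blocks and their second moment *)

Section Placements.
Context {R : realType} {V U : finType} {m : nat}.
Variable j : V * 'I_m -> U.
Hypothesis j_inj : injective j.
Implicit Types (phi psi : {ffun V -> 'I_m}) (G : graph V) (E : {set pairs V}).

Definition placement phi (x : V) : U := j (x, phi x).

Definition agreement phi psi : {set V} := [set x | phi x == psi x]%SET.

Lemma placement_inj phi : injective (placement phi).
Proof. by move=> x y /j_inj[]. Qed.

Lemma card_placement phi E : #|edge_image (placement phi) E| = #|E|.
Proof.
apply: (@card_edge_image _ _ _ [set: V]%SET) => [x y _ _|e _].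
  exact: placement_inj.
exact: finset.subsetT.
Qed.

(** A common vertex is [j (x, phi x) = j (y, psi y)], and injectivity of [j] gives both [x = y] and
    [phi x = psi x]. *)
Lemma placementI_subset phi psi E :
  edge_image (placement phi) E :&: edge_image (placement psi) E \subset
  edge_image (placement phi) (edges_within E (agreement phi psi)).
Proof.
apply/fintype.subsetP => e; rewrite finset.inE => /andP[/edge_imageP[e1 e1E ee1]].
move=> /edge_imageP[e2 _ ee2]; apply/edge_imageP; exists e1 => //.
rewrite finset.inE e1E; apply/fintype.subsetP => x xe1; rewrite finset.inE.
have : placement phi x \in (placement psi @: val e2)%SET.
  by rewrite -ee2 ee1 imset_f.
by move=> /imsetP[y _] /j_inj[<- ->].
Qed.

Lemma card_placementU phi psi E :
  (#|E| + #|E| <= #|edge_image (placement phi) E :|: edge_image (placement psi) E|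
    + #|edges_within E (agreement phi psi)|)%N.
Proof.
rewrite -{1}(card_placement phi E) -{1}(card_placement psi E) -cardsUI leq_add2l.
by rewrite -(card_placement phi (edges_within _ _)) subset_leq_card ?placementI_subset.
Qed.

(** The summand is a product over [x], so the sum factors; each factor is [m + (m - 1)], at most
    [2m]. *)
Lemma sum_agreement phi :
  \sum_(psi : {ffun V -> 'I_m}) m%:R ^+ #|agreement phi psi| <=
  (2 * m%:R) ^+ #|V| :> R.
Proof.
pose F x (y : 'I_m) : R := if phi x == y then m%:R else 1.
rewrite (eq_bigr (fun psi : {ffun V -> 'I_m} => \prod_x F x (psi x))); last first.
  move=> psi _; rewrite -prodr_const [LHS]big_mkcond /=; apply: eq_bigr => x _.
  by rewrite finset.inE.
rewrite -bigA_distr_bigA -prodr_const; apply: ler_prod => x _.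
have F0 y : 0 <= F x y by rewrite /F; case: ifP.
rewrite sumr_ge0 //= (bigD1 (phi x)) //= {1}/F eqxx mulr2n mulrDl mul1r lerD2l.
rewrite (eq_bigr (fun=> 1)) => [|y /negPf]; last by rewrite /F eq_sym => ->.
rewrite sumr_const ler_nat; apply: leq_trans (max_card _) _.
by rewrite card_ord.
Qed.

(** Chebyshev's inequality with mean [#|P| * p ^ e], where [e] is the number of edges of [G]. The
    density hypothesis bounds the variance by [p ^ (2e) * m ^ v * (2m) ^ v / C] with [v = #|V|], and
    [m ^ v <= k * #|P|] turns the ratio into [k ^ 2 * 2 ^ v / C]. *)
Lemma placement_avoid_measure G (P : pred {ffun V -> 'I_m}) (k : nat) (C p : R) :
  0 < C -> 0 < p <= 1 -> (0 < m)%N -> (0 < k)%N ->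
  (m ^ #|V| <= k * #|P|)%N ->
  (forall W, edges_within (edges G) W != finset.set0 ->
     C <= p ^+ #|edges_within (edges G) W| * m%:R ^+ #|W|) ->
  product_measure p [set A : {set pairs U} | [forall (phi | P phi),
     ~~ (edge_image (placement phi) (edges G) \subset A)]]%SET <=
  k%:R ^+ 2 * 2 ^+ #|V| / C.
Proof.
move=> C0 /andP[p0 p1] m0 k0 mkP dense; set E := edges G.
pose S phi := edge_image (placement phi) E.
have p01 : 0 <= p <= 1 by rewrite ltW.
have m0R : 0 < m%:R :> R by rewrite ltr0n.
have := product_measure_avoid_le p01 P S.
have -> : \sum_(phi | P phi) p ^+ #|S phi| = #|P|%:R * p ^+ #|E|.
  under eq_bigr do rewrite card_placement.
  by rewrite sumr_const mulr_natl.
set mu := product_measure _ _ => muP.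
have second_moment : \sum_(phi | P phi) \sum_(psi | P psi) p ^+ #|S phi :|: S psi| <=
    p ^+ #|E| ^+ 2 * (#|P|%:R ^+ 2 + m%:R ^+ #|V| * (2 * m%:R) ^+ #|V| / C).
  apply: le_trans (_ : \sum_(phi | P phi) \sum_(psi | P psi)
      (p ^+ #|E| ^+ 2 * (1 + m%:R ^+ #|agreement phi psi| / C)) <= _).
    apply: ler_sum => phi _; apply: ler_sum => psi _.
    set a := #|edges_within E (agreement phi psi)|.
    have pa0 : 0 < p ^+ a by rewrite exprn_gt0.
    (* After multiplication by [p ^ a] the left side is at most [p ^ (2e)]. If [a = 0] the summand 1
       alone suffices; otherwise the density hypothesis for the agreement set makes the second
       summand suffice. *)
    rewrite -(ler_pM2r pa0) -exprD.
    apply: le_trans (_ : p ^+ #|E| ^+ 2 * 1 <= _).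
      by rewrite mulr1 -exprM muln2 -addnn ler_wiXn2l ?(ltW p0) // card_placementU.
    rewrite -[leRHS]mulrA ler_pM2l ?exprn_gt0 // mulrDl mul1r mulrAC.
    have [a0|a0] := posnP a.
      rewrite a0 expr0 lerDl mulr1 divr_ge0 ?(ltW C0) // exprn_ge0 //.
    apply: ler_wpDl; first exact: ltW.
    rewrite ler_pdivlMr // mul1r mulrC; apply: dense.
    by rewrite -card_gt0.
  under eq_bigr do rewrite -mulr_sumr.
  rewrite -mulr_sumr ler_pM2l ?exprn_gt0 //.
  under eq_bigr do rewrite big_split /= sumr_const -mulr_suml.
  rewrite big_split /= sumr_const -mulrnA -natrX mulnn lerD2l -mulr_suml.
  rewrite ler_pM2r ?invr_gt0 //.
  (* All terms are nonnegative, so both sums may be extended from [P] to all functions. *)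
  apply: le_trans (_ : \sum_(phi : {ffun V -> 'I_m}) (2 * m%:R) ^+ #|V| <= _).
    rewrite [leLHS]big_mkcond; apply: ler_sum => phi _.
    apply: le_trans (sum_agreement phi); case: ifP => _; last first.
      by apply: sumr_ge0 => psi _; apply: exprn_ge0.
    by rewrite [leLHS]big_mkcond; apply: ler_sum => psi _; case: ifP.
  by rewrite sumr_const card_ffun card_ord -natrX [leRHS]mulr_natl.
have P0 : 0 < #|P|%:R :> R.
  rewrite ltr0n; have : (0 < k * #|P|)%N by apply: leq_trans mkP; rewrite expn_gt0 m0.
  by rewrite muln_gt0 => /andP[].
have q0 : 0 < p ^+ #|E| ^+ 2 by rewrite !exprn_gt0.
have mkPR : m%:R ^+ #|V| <= k%:R * #|P|%:R :> R by rewrite -natrX -natrM ler_nat.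
have {muP} muP : #|P|%:R ^+ 2 * mu <= m%:R ^+ #|V| * (2 * m%:R) ^+ #|V| / C.
  rewrite -(ler_pM2l q0); rewrite exprMn in muP.
  rewrite mulrCA mulrA; apply: le_trans muP _.
  rewrite lerBlDr; apply: le_trans second_moment _.
  by rewrite mulrDr addrC [X in _ + X]mulrC.
rewrite -(ler_pM2l (exprn_gt0 2 P0)); apply: le_trans muP _.
rewrite 2!mulrA ler_pM2r ?invr_gt0 // exprMn [X in X <= _]mulrCA.
rewrite [leLHS]mulrC ler_pM2r ?exprn_gt0 // -expr2 mulrC -exprMn.
by rewrite lerXn2r // nnegrE ?exprn_ge0 ?mulr_ge0.
Qed.

End Placements.

(** [C ^ a >= C] because [a] is positive, and the total exponent [w - a / d] of [m] is
    nonnegative. *)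
Lemma scaled_power_ge (R : realType) (C d : R) (m a w : nat) :
  1 <= C -> 0 < d -> (0 < m)%N -> (0 < a)%N -> a%:R <= d * w%:R ->
  C <= (C * m%:R `^ (- d^-1)) ^+ a * m%:R ^+ w.
Proof.
move=> C1 d0 m0 a0 adw; have m1 : 1 <= m%:R :> R by rewrite ler1n.
have m0R : 0 < m%:R :> R by rewrite ltr0n.
rewrite exprMn -mulrA -[leLHS]mulr1.
apply: ler_pM => //; [exact: le_trans C1|exact: ler_eXnr|].
rewrite -(powR_mulrn a (powR_ge0 _ _)) -powRrM.
rewrite -(powR_mulrn w (ler0n R m)) -powRD; last first.
  by rewrite (gt_eqF m0R) implybT.
rewrite -[leLHS](powRr0 m%:R); apply: ler_powR => //.
by rewrite mulNr addrC subr_ge0 ler_pdivrMl.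
Qed.

(** * Upper bound on the threshold *)

Section UpperBound.
Context {R : realType} {V : finType}.
Variables (H : graph V) (k : nat).
Hypotheses (H0 : edges H != finset.set0) (k0 : (0 < k)%N).

Let d : R := k_density k H.
(** Chosen so that the Chebyshev bound [k ^ 2 * 2 ^ v / C] equals [1 / 4]. *)
Let C : R := 4 * k%:R ^+ 2 * 2 ^+ #|V|.

(* Fewer than a [1/k] proportion of the placements of each piece fall outside
   [D], so some placement puts all [k] pieces in [D]. *)
Lemma kfold_union_meets (n m : nat) (D : {set {set pairs 'I_n}}) :
  (0 < m)%N -> (#|V| * m <= n)%N -> C * m%:R `^ (- d^-1) <= 1 ->
  decreasing_family D ->
  1 - (2 * k%:R)^-1 <= product_measure (C * m%:R `^ (- d^-1)) D ->
  kfold_union k D :&: containing_family H n != finset.set0.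
Proof.
set p := C * _ => m0 mn p1 decD muD.
have d0 : 0 < d by apply: k_density_gt0.
have k1 : 1 <= k%:R :> R by rewrite ler1n.
have two1 : 1 <= 2 ^+ #|V| :> R by rewrite exprn_ege1 // ler1n.
have C1 : 1 <= C.
  have := ler_pM ler01 ler01 (exprn_ege1 2 k1) two1; rewrite /C; lra.
have p0 : 0 < p by rewrite mulr_gt0 ?powR_gt0 ?ltr0n // (lt_le_trans _ C1).
have cardVm : (#|{: V * 'I_m}| <= n)%N by rewrite card_prod card_ord.
pose j (x : V * 'I_m) : 'I_n := widen_ord cardVm (enum_rank x).
have j_inj : injective j.
  by move=> x y /(congr1 val) /= /val_inj/enum_rank_inj.
have [F [FP Fd]] := k_density_attained (R := R) H k0.
pose S i phi := edge_image (placement j phi) (edges (F i)).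
pose bad i := [pred phi | S i phi \notin D].
have bad_lt i : (k * #|bad i| < m ^ #|V|)%N.
  rewrite ltnNge; apply/negP => mbad.
  have dense W : edges_within (edges (F i)) W != finset.set0 ->
      C <= p ^+ #|edges_within (edges (F i)) W| * m%:R ^+ #|W|.
    move=> W0; apply: scaled_power_ge => //; first by rewrite card_gt0.
    (* Restricting [F i] to [W] gives a subgraph, whose edge count is at most [d * #|W|] by the
       choice of [F]. *)
    have wfJ : wf_graph (W :&: vertices (F i), edges_within (edges (F i)) W)%SET.
      apply/forall_inP => e; rewrite finset.inE finset.subsetI => /andP[eF ->] /=.
      exact: edge_subset.
    have := card_edges_le_density (J := exist (@wf_graph V) _ wfJ) (Fd i).
    rewrite /subgraph /= finset.subsetIr => /(_ _)/le_trans; apply.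
      by apply/fintype.subsetP => e; rewrite finset.inE => /andP[].
    by rewrite ler_pM2l // ler_nat subset_leq_card // finset.subsetIl.
  have p01 : 0 < p <= 1 by rewrite p0.
  have := placement_avoid_measure j_inj (lt_le_trans ltr01 C1) p01 m0 k0 mbad dense.
  have -> : k%:R ^+ 2 * 2 ^+ #|V| / C = 4^-1.
    by rewrite /C; field; rewrite !gt_eqF ?exprn_gt0 ?ltr0n.
  apply/negP; rewrite -ltNge.
  (* As [D] is decreasing, none of its members contains a bad placement, so [D] lies in the avoiding
     event. Its measure is at least [1 - 1 / (2k) >= 1 / 2], above [1 / 4]. *)
  apply: lt_le_trans (product_measure_le (F := D) _ _); last first.
  - apply/fintype.subsetP => A AD; rewrite finset.inE; apply/forall_inP => phi.
    by apply: contra => SA; apply: decD AD SA.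
  - by rewrite ltW.
  have : (2 * k%:R)^-1 <= 2^-1 :> R by rewrite lef_pV2 ?posrE; lra.
  by move=> kV; apply: lt_le_trans muD; lra.
have [phi phiD] : exists phi, forall i, S i phi \in D.
  apply: contrapT => nophi.
  (* If every [phi] were bad for some [i], the bad sets would cover all [m ^ #|V|] functions.
     Summing the [k] strict bounds [bad_lt] contradicts this, since [k] is positive. *)
  have : (k * m ^ #|V| <= k * \sum_(i < k) #|bad i|)%N.
    rewrite leq_mul2l; apply/orP; right.
    rewrite -[X in (X ^ _)%N]card_ord -card_ffun -sum1_card.
    under [X in (_ <= X)%N]eq_bigr do rewrite -sum1_card big_mkcond.
    rewrite exchange_big /=; apply: leq_sum => phi _.
    have [i iD] : exists i, S i phi \notin D.
      apply: contrapT => noi; apply: nophi; exists phi => i.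
      by apply: contrapT => /negP iD; apply: noi; exists i.
    by rewrite (bigD1 i) //= inE iD.
  apply/negP; rewrite -ltnNge big_distrr /= -[X in (_ < X * _)%N]card_ord.
  rewrite -sum_nat_const.
  have : (\sum_(i < k) (k * #|bad i|).+1 <= \sum_(i < k) m ^ #|V|)%N.
    by apply: leq_sum => i _; apply: bad_lt.
  apply: leq_trans; rewrite [leqRHS](eq_bigr (fun i => 1 + k * #|bad i|)%N) //.
  by rewrite big_split /= sum1_card card_ord -add1n leq_add2r.
apply/set0Pn; exists (\bigcup_(i < k) S i phi)%SET; rewrite finset.inE.
apply/andP; split.
  apply/imsetP; exists [ffun i => S i phi].
    by apply/ffun_onP => i; rewrite ffunE; apply: phiD.
  by apply: eq_bigr => i _; rewrite ffunE.
rewrite edge_image_bigcup finset.inE; apply/asboolP.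
case/andP: FP => _ /eqP ->.
by apply: (embedding_isomorphic (placement_inj j_inj (phi := phi))).
Qed.

Lemma upper_bound : exists (K : R) (N : nat), 0 < K /\
  forall n, (N <= n)%N -> exists p : R, [/\ 0 <= p <= 1,
    p <= K * n%:R `^ (- d^-1) &
    forall D : {set {set pairs 'I_n}}, decreasing_family D ->
      1 - (2 * k%:R)^-1 <= product_measure p D ->
      kfold_union k D :&: containing_family H n != finset.set0].
Proof.
have d0 : 0 < d by apply: k_density_gt0.
have dV0 : 0 <= d^-1 by rewrite invr_ge0 ltW.
have C0 : 0 < C by rewrite !mulr_gt0 ?exprn_gt0 ?ltr0n.
have V0 : (0 < #|V|)%N.
  by have /set0Pn[e _] := H0; apply: leq_trans (max_card (val e)); rewrite (eqP (valP e)).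
(* [m >= M] forces [m >= C ^ d], hence [p <= 1]. The factor [(2 * #|V|) ^ (1 / d)] below pays for
   replacing [m = n %/ #|V|] by [n], as [n <= 2 * #|V| * m]. *)
pose M := (Num.bound (C `^ d)).+1.
exists (C * (2 * #|V|%:R) `^ d^-1), (M * #|V|)%N; split.
  by rewrite mulr_gt0 // powR_gt0 // mulr_gt0 ?ltr0n.
move=> n Mn; pose m := (n %/ #|V|)%N.
have Mm : (M <= m)%N by rewrite leq_divRL.
have m0 : (0 < m)%N by apply: leq_trans Mm.
have p1 : C * m%:R `^ (- d^-1) <= 1.
  rewrite powRN ler_pdivrMr ?powR_gt0 ?ltr0n // mul1r.
  have -> : C = (C `^ d) `^ d^-1.
    by rewrite -powRrM mulfV ?gt_eqF // powRr1 // ltW.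
  apply: ge0_ler_powR; rewrite ?nnegrE ?powR_ge0 //.
  apply: le_trans (_ : M%:R <= _); last by rewrite ler_nat.
  apply: le_trans (ltW (archi_boundP (powR_ge0 _ _))) _.
  by rewrite ler_nat /M.
exists (C * m%:R `^ (- d^-1)); split.
- by rewrite p1 mulr_ge0 ?powR_ge0 ?(ltW C0).
- rewrite -mulrA ler_pM2l // !powRN.
  rewrite ler_pdivlMr ?powR_gt0 ?ltr0n //; last by apply: leq_trans Mn; rewrite muln_gt0.
  rewrite mulrC ler_pdivrMr ?powR_gt0 ?ltr0n //.
  have nm : n%:R <= 2 * #|V|%:R * m%:R :> R.
    rewrite -!natrM ler_nat {1}(divn_eq n #|V|) -/m.
    apply: leq_trans (_ : m * #|V| + #|V| <= _)%N.
      by rewrite leq_add2l ltnW // ltn_pmod.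
    by rewrite -mulnA mul2n -addnn [(#|V| * m)%N]mulnC leq_add2l leq_pmull.
  by rewrite -powRM ?mulr_ge0 //; apply: ge0_ler_powR nm => //; rewrite nnegrE.
- move=> D; apply: kfold_union_meets => //.
  by rewrite mulnC leq_divM.
Qed.

End UpperBound.

(** * Passage from the two bounds to the infimum *)

Theorem theorem1p10 (R : realType) (V : finType) (H : graph V) (k : nat) :
  edges H != finset.set0 -> (0 < k)%N ->
  (fun n : nat => graph_threshold H k n : R^o) =Theta_\oo
  (fun n : nat => n%:R `^ (- (k_density k H)^-1) : R^o).
Proof.
move=> H0 k0; have [c c0 lower] := @lower_bound R V H k H0 k0.
have [K [N [K0 upper]]] := @upper_bound R V H k H0 k0.
rewrite eqThetaE qualifE; apply/asboolP; exists (c, K); first by rewrite c0 K0.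
exists N.+1 => // n /= Nn.
have n0 : (0 < n)%N by apply: leq_trans Nn.
have [p [p01 pK pthr]] := upper n (ltnW Nn).
rewrite [X in c * X]ger0_norm ?powR_ge0 // [X in K * X]ger0_norm ?powR_ge0 //.
rewrite /graph_threshold /threshold; set T := [set q : R | _].
(* This member of [T] bounds the infimum from above and also makes [T] nonempty, so that a lower
   bound of [T] is one of its infimum. *)
have Tp : T p by split.
have lbT : lbound T (c * n%:R `^ (- (k_density k H)^-1)).
  by move=> q [q01 qthr]; apply: lower.
have cT : c * n%:R `^ (- (k_density k H)^-1) <= inf T.
  by apply: lb_le_inf => //; exists p.
rewrite ger0_norm; last by apply: le_trans cT; rewrite mulr_ge0 ?powR_ge0 ?ltW.
split=> //; apply: le_trans pK; apply: ge_inf => //.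
by exists (c * n%:R `^ (- (k_density k H)^-1)).
Qed.
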